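(* For every two finite vertex transitive graphs $G_1$ and $G_2$, the following statements are equivalent: (1) $i(G_1\times G_2)\le \max\{a^*(G_1),a^*(G_2)\}$; (2) $a^*(G_1\times G_2)\le \max\{a^*(G_1),a^*(G_2)\}$; (3) $\chi_f(G_1\times G_2)=\min\{\chi_f(G_1),\chi_f(G_2)\}$; (4) $A(G_1+G_2)=\max\{A(G_1),A(G_2)\}$.
   Context: Tensor product $G\times H$: vertex set $V(G)\times V(H)$, $(u,v)\sim(u',v')$ iff $uu'\in E(G)$ and $vv'\in E(H)$; $G^n$ is the $n$-fold tensor power. $i(G)=\alpha(G)/|V(G)|$, $A(G)=\lim_{n\to\infty} i(G^n)$. $N(I)$ is the set of vertices with a neighbor in $I$; $a(G)=\max_I \frac{|I|}{|I|+|N(I)|}$ over nonempty independent sets $I$; $a^*(G)=a(G)$ if $a(G)\le\frac12$ and $a^*(G)=1$ otherwise. $\chi_f$ is the fractional chromatic number and $G_1+G_2$ is the disjoint union. *)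

(* Defs.v *)
From HB Require Import structures.
From mathcomp Require Import all_boot all_order all_algebra fingroup perm.
From mathcomp Require Import classical_sets reals topology normedtype sequences.

Set Implicit Arguments.
Unset Strict Implicit.
Unset Printing Implicit Defensive.

Import Order.TTheory GRing.Theory Num.Theory.
Import numFieldNormedType.Exports.

Local Open Scope ring_scope.

Record sgraph := SGraph {
  vertex :> finType;
  adj : rel vertex;
  adj_sym : symmetric adj;
  adj_irr : irreflexive adj }.

Definition tensor_adj (G H : sgraph) : rel (G * H)%type :=
  fun x y => adj x.1 y.1 && adj x.2 y.2.

Lemma tensor_adj_sym (G H : sgraph) : symmetric (@tensor_adj G H).
Proof. by move=> x y; rewrite /tensor_adj !(adj_sym x.1) !(adj_sym x.2). Qed.

Lemma tensor_adj_irr (G H : sgraph) : irreflexive (@tensor_adj G H).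
Proof. by move=> x; rewrite /tensor_adj adj_irr. Qed.

Definition tensor (G H : sgraph) : sgraph :=
  SGraph (@tensor_adj_sym G H) (@tensor_adj_irr G H).

(* The n-fold power for 1 <= n. The 0-fold power would be a single looped
   vertex, which is not a simple graph; tensor_pow G 0 is arbitrarily G. *)
Definition tensor_pow (G : sgraph) (n : nat) : sgraph :=
  iter n.-1 (fun H => tensor H G) G.

Definition union_adj (G H : sgraph) : rel (G + H)%type :=
  fun x y => match x, y with
    | inl u, inl v => adj u v
    | inr u, inr v => adj u v
    | _, _ => false
    end.

Lemma union_adj_sym (G H : sgraph) : symmetric (@union_adj G H).
Proof. by move=> [u|u] [v|v] //=; rewrite adj_sym. Qed.

Lemma union_adj_irr (G H : sgraph) : irreflexive (@union_adj G H).
Proof. by move=> [u|u] /=; rewrite adj_irr. Qed.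

Definition disjoint_union (G H : sgraph) : sgraph :=
  SGraph (@union_adj_sym G H) (@union_adj_irr G H).

Definition automorphism (G : sgraph) (s : {perm G}) : Prop :=
  forall u v : G, adj (s u) (s v) = adj u v.

Definition vertex_transitive (G : sgraph) : Prop :=
  forall u v : G, exists2 s : {perm G}, automorphism s & s u = v.

Definition independent (G : sgraph) (I : {set G}) : bool :=
  [forall u in I, forall v in I, ~~ adj u v].

Definition nbhd (G : sgraph) (I : {set G}) : {set G} :=
  [set v | [exists u in I, adj u v]]%SET.

Definition alpha (G : sgraph) : nat :=
  \max_(I : {set G} | independent I) #|I|.

Definition indep_ratio (R : realType) (G : sgraph) : R :=
  (alpha G)%:R / #|G|%:R.

(* The ratios i(G^n) are nondecreasing and at most 1, so this limit exists. *)
Definition ultimate_ratio (R : realType) (G : sgraph) : R :=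
  lim (indep_ratio R (tensor_pow G n) @[n --> \oo])%classic.

(* The ratios are nonnegative, so the base value 0 of the maximum is harmless
   as soon as G has a vertex. *)
Definition expansion_ratio (R : realType) (G : sgraph) : R :=
  \big[Num.max/0]_(I : {set G} | independent I && (I != finset.set0))
    (#|I|%:R / (#|I| + #|nbhd I|)%:R).

Definition expansion_ratio_star (R : realType) (G : sgraph) : R :=
  if expansion_ratio R G <= 1 / 2 then expansion_ratio R G else 1.

(* Only the weights of independent sets matter. *)
Definition fractional_coloring (R : realType) (G : sgraph)
    (w : {set G} -> R) : Prop :=
  (forall I, independent I -> 0 <= w I) /\
  (forall v : G, 1 <= \sum_(I : {set G} | independent I && (v \in I)) w I).

Definition chi_f (R : realType) (G : sgraph) : R :=
  inf [set \sum_(I : {set G} | independent I) w I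
        | w in [set w : {set G} -> R | fractional_coloring w]]%classic.

(* Main.v *)
(* For a vertex-transitive graph G, averaging a maximum independent set over
   the automorphisms of G gives a(G) = i(G) = 1 / chi_f(G) and the
   no-homomorphism lemma: a homomorphism from H to G forces i(G) <= i(H). As G
   and G^n map to each other, i(G^n) = i(G) and A(G) = i(G); moreover i(G) is
   1 or at most 1/2, so a*(G) = i(G). Up to isomorphism, (G1 + G2)^n is the
   disjoint union of G1^n, G2^n and vertex-transitive graphs homomorphically
   equivalent to G1 x G2, whence A(G1 + G2) = i(G1 x G2). All four statements
   thus say that i(G1 x G2) <= max {i(G1), i(G2)}, where the reverse inequality
   always holds because of the two projections. *)
Require Import Defs.
From mathcomp Require Import all_boot all_order all_algebra fingroup perm.
From mathcomp Require Import reals topology normedtype sequences.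
From mathcomp Require boolp classical_sets.
From mathcomp Require Import ring.

Set Implicit Arguments.
Unset Strict Implicit.
Unset Printing Implicit Defensive.

Import Order.TTheory GRing.Theory Num.Theory.
Import numFieldNormedType.Exports.

Local Open Scope nat_scope.

(** * Independent sets and the independence number *)

Lemma independentP (G : sgraph) (I : {set G}) :
  reflect {in I &, forall u v, ~~ adj u v} (independent I).
Proof.
apply: (iffP forall_inP) => [h u v uI vI|h u uI].
  by move/forall_inP: (h u uI); apply.
by apply/forall_inP => v vI; apply: h.
Qed.

Lemma leq_alpha (G : sgraph) (I : {set G}) : independent I -> #|I| <= alpha G.
Proof. exact: leq_bigmax_cond. Qed.

Lemma alpha_witness (G : sgraph) :
  exists2 J : {set G}, independent J & #|J| = alpha G.
Proof.
have ind0 : independent (set0 : {set G}).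
  by apply/independentP => u v; rewrite inE.
have : 0 < #|[pred I : {set G} | independent I]|.
  by apply/card_gt0P; exists set0.
move/(eq_bigmax_cond (fun I : {set G} => #|I|)) => [J indJ eqJ].
by exists J => //; rewrite /alpha eqJ.
Qed.

Lemma alpha_gt0 (G : sgraph) : 0 < #|G| -> 0 < alpha G.
Proof.
move/card_gt0P => [x _]; rewrite -(cards1 x); apply: leq_alpha.
by apply/independentP => u v /set1P -> /set1P ->; rewrite adj_irr.
Qed.

Lemma alpha_leq_card (G : sgraph) : alpha G <= #|G|.
Proof. by have [J _ <-] := alpha_witness G; apply: max_card. Qed.

(** * Homomorphisms, tensor products and powers *)

Definition homomorphism (G H : sgraph) (f : G -> H) : Prop :=
  forall x y, adj x y -> adj (f x) (f y).

Definition hom_to (G H : sgraph) : Prop :=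
  exists f : G -> H, homomorphism f.

Definition isomorphic (G H : sgraph) : Prop :=
  exists2 f : G -> H, bijective f & forall x y, adj (f x) (f y) = adj x y.

Lemma independent_preim (G H : sgraph) (f : G -> H) (J : {set H}) :
  homomorphism f -> independent J -> independent (f @^-1: J).
Proof.
move=> homf /independentP indJ; apply/independentP => u v; rewrite !inE => uJ vJ.
by apply: contra (indJ _ _ uJ vJ) => /homf.
Qed.

Lemma hom_to_trans (G H K : sgraph) : hom_to G H -> hom_to H K -> hom_to G K.
Proof.
by move=> [f homf] [g homg]; exists (g \o f) => x y /homf /homg.
Qed.

Lemma hom_to_id (G : sgraph) : hom_to G G.
Proof. by exists id. Qed.

Lemma hom_to_fst (G H : sgraph) : hom_to (tensor G H) G.
Proof. by exists fst => x y /andP[]. Qed.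

Lemma hom_to_snd (G H : sgraph) : hom_to (tensor G H) H.
Proof. by exists snd => x y /andP[]. Qed.

Lemma hom_to_tensor (G H K : sgraph) :
  hom_to K G -> hom_to K H -> hom_to K (tensor G H).
Proof.
move=> [f homf] [g homg]; exists (fun x => (f x, g x)) => x y xy.
by apply/andP; split; [apply: homf|apply: homg].
Qed.

Lemma hom_to_pow (G : sgraph) n : hom_to G (tensor_pow G n).
Proof.
rewrite /tensor_pow; elim: n.-1 => [|m IHm]; first exact: hom_to_id.
exact/(hom_to_tensor IHm)/hom_to_id.
Qed.

Lemma pow_hom_to (G : sgraph) n : hom_to (tensor_pow G n) G.
Proof.
rewrite /tensor_pow; case: n.-1 => [|m]; first exact: hom_to_id.
exact: hom_to_snd.
Qed.

Lemma card_tensor (G H : sgraph) : #|tensor G H| = #|G| * #|H|.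
Proof. exact: card_prod. Qed.

Lemma card_tensor_powS (G : sgraph) n : #|tensor_pow G n.+1| = #|G| ^ n.+1.
Proof.
rewrite /tensor_pow /=; elim: n => //= n IHn.
by rewrite card_prod IHn [RHS]expnS mulnC.
Qed.

Lemma vertex_transitive_tensor (G H : sgraph) :
  vertex_transitive G -> vertex_transitive H -> vertex_transitive (tensor G H).
Proof.
move=> vtG vtH [u1 u2] [v1 v2].
have [s auts <-] := vtG u1 v1; have [t autt <-] := vtH u2 v2.
have inj_st : injective (fun x : tensor G H => (s x.1, t x.2)).
  by move=> [a b] [c d] /= [/perm_inj -> /perm_inj ->].
exists (perm inj_st); last by rewrite permE.
by move=> x y; rewrite !permE /= /tensor_adj /= auts autt.
Qed.

Lemma vertex_transitive_pow (G : sgraph) n :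
  vertex_transitive G -> vertex_transitive (tensor_pow G n).
Proof.
move=> vtG; rewrite /tensor_pow; elim: n.-1 => //= m IHm.
exact: vertex_transitive_tensor.
Qed.

(** * Averaging over the automorphisms of a vertex-transitive graph *)

Definition Aut_graph (G : sgraph) : {set {perm G}} :=
  [set s : {perm G} | [forall u, forall v, adj (s u) (s v) == adj u v]].

Lemma Aut_graphP (G : sgraph) (s : {perm G}) :
  reflect (automorphism s) (s \in Aut_graph G).
Proof.
rewrite inE; apply: (iffP forallP) => [h u v|h u].
  by move/forallP: (h u) => /(_ v)/eqP.
by apply/forallP => v; apply/eqP.
Qed.

Lemma Aut_graph_gt0 (G : sgraph) : 0 < #|Aut_graph G|.
Proof.
by apply/card_gt0P; exists 1%g; apply/Aut_graphP => u v; rewrite !perm1.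
Qed.

Lemma card_preim_perm (G : sgraph) (s : {perm G}) (J : {set G}) :
  #|s @^-1: J| = #|J|.
Proof. by rewrite card_preimset //; apply: perm_inj. Qed.

(** The number [c u] of automorphisms sending [u] into [J] does not depend on [u]: composing with an
    automorphism that takes [w] to [u] injects those counted by [c u] into those counted by [c w].
    Then count the pairs [(u, s)] with [s u \in J] in two ways. *)
Lemma card_Aut_translates (G : sgraph) (J : {set G}) (v : G) :
  vertex_transitive G ->
  #|G| * #|[set s in Aut_graph G | s v \in J]| = #|J| * #|Aut_graph G|.
Proof.
move=> vtG; set c := fun v => #|[set s in Aut_graph G | s v \in J]|.
have c_le u w : c u <= c w.
  have [t autt tw] := vtG w u.
  rewrite /c -(card_imset _ (mulgI t)); apply/subset_leq_card/subsetP => r.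
  case/imsetP => s; rewrite inE => /andP[/Aut_graphP auts sJ] ->.
  rewrite inE permM tw sJ andbT; apply/Aut_graphP => x y.
  by rewrite !permM auts autt.
have c_cst u : c u = c v by apply/eqP; rewrite eqn_leq !c_le.
transitivity (\sum_(u : G) c u).
  by rewrite (eq_bigr (fun=> c v)) ?sum_nat_const // => u _; apply: c_cst.
transitivity (\sum_(s in Aut_graph G) #|s @^-1: J|); last first.
  rewrite (eq_bigr (fun=> #|J|)) ?sum_nat_const 1?mulnC // => s _.
  exact: card_preim_perm.
rewrite (eq_bigr (fun u => \sum_(s in Aut_graph G | s u \in J) 1)).
  rewrite (exchange_big_dep (mem (Aut_graph G))) /=; last by move=> ? ? _ /andP[].
  apply: eq_bigr => s auts; rewrite -sum1_card; apply: eq_bigl => u.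
  by rewrite auts inE.
by move=> u _; rewrite /c -sum1_card; apply: eq_bigl => s; rewrite inE.
Qed.

(* Double counting: each point of [D] is mapped into [J] by the same proportion
   #|J| / #|G| of the automorphisms. *)
Lemma sum_translates (T : finType) (G : sgraph) (f : T -> G) (D : {set T})
    (J : {set G}) :
  vertex_transitive G ->
  #|G| * \sum_(s in Aut_graph G) #|[set x in D | s (f x) \in J]|
    = #|J| * #|Aut_graph G| * #|D|.
Proof.
move=> vtG.
rewrite (eq_bigr (fun s : {perm G} => \sum_(x in D | s (f x) \in J) 1)).
  rewrite (exchange_big_dep (mem D)) /=; last by move=> ? ? _ /andP[].
  rewrite big_distrr (eq_bigr (fun=> #|J| * #|Aut_graph G|)) /=; last first.
    move=> x xD; rewrite -(card_Aut_translates J (f x) vtG).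
    by congr (_ * _); rewrite -sum1_card; apply: eq_bigl => s; rewrite xD inE.
  by rewrite sum_nat_const mulnC.
by move=> s _; rewrite -sum1_card; apply: eq_bigl => x; rewrite inE.
Qed.

Lemma homomorphism_comp_aut (G H : sgraph) (f : G -> H) (s : {perm H}) :
  homomorphism f -> s \in Aut_graph H -> homomorphism (s \o f).
Proof. by move=> homf /Aut_graphP auts x y /homf xy; rewrite /= auts. Qed.

(* The no-homomorphism lemma of Albertson and Collins. *)
Lemma no_homomorphism (G H : sgraph) :
  vertex_transitive H -> hom_to G H -> alpha H * #|G| <= alpha G * #|H|.
Proof.
move=> vtH [f homf]; have [J indJ <-] := alpha_witness H.
(* Taking [D] to be all of [G] in [sum_translates] reduces the claim to one automorphism [s]: the
   preimage of [J] under [s \o f] is independent in [G]. *)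
rewrite -(leq_pmul2r (Aut_graph_gt0 H)) mulnAC -[#|G|]cardsT.
rewrite -(sum_translates f _ _ vtH) mulnAC [leqLHS]mulnC leq_mul2r.
apply/orP; right; rewrite mulnC -sum_nat_const; apply: leq_sum => s auts.
have/leq_alpha := independent_preim (homomorphism_comp_aut homf auts) indJ.
apply: leq_trans; apply/subset_leq_card/subsetP => x.
by rewrite !inE.
Qed.

Lemma alpha_mul_hom_equiv (G H : sgraph) :
  vertex_transitive G -> vertex_transitive H -> hom_to G H -> hom_to H G ->
  alpha G * #|H| = alpha H * #|G|.
Proof.
by move=> vtG vtH GH HG; apply/eqP; rewrite eqn_leq !no_homomorphism.
Qed.

Lemma alpha_pow (G : sgraph) n :
  vertex_transitive G ->
  alpha (tensor_pow G n) * #|G| = alpha G * #|tensor_pow G n|.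
Proof.
move=> vtG; apply: alpha_mul_hom_equiv => //; first exact: vertex_transitive_pow.
  exact: pow_hom_to.
exact: hom_to_pow.
Qed.

(** If [u] and [v] are adjacent, no automorphism sends both into an independent set, so averaging
    over [D = {u, v}] bounds the ratio by one half. Without edges the whole vertex set is
    independent. *)
Lemma alpha_half_or_full (G : sgraph) :
  vertex_transitive G -> alpha G * 2 <= #|G| \/ alpha G = #|G|.
Proof.
move=> vtG; case: (boolP [exists u : G, exists v : G, adj u v]) => [|noE].
  case/existsP => u /existsP[v uv]; left.
  have [J /independentP indJ <-] := alpha_witness G.
  have uDv : u != v by apply: contraTneq uv => ->; rewrite adj_irr.
  rewrite -(leq_pmul2r (Aut_graph_gt0 G)) mulnAC.
  have -> : 2 = #|[set u; v]| by rewrite cards2 uDv.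
  rewrite -(sum_translates id _ _ vtG) leq_mul2l; apply/orP; right.
  rewrite -sum1_card; apply: leq_sum => s auts.
  case: (boolP (s u \in J)) => suJ; last first.
    rewrite -(cards1 v); apply/subset_leq_card/subsetP => x.
    by rewrite !inE => /andP[/orP[]/eqP-> //]; rewrite (negPf suJ).
  rewrite -(cards1 u); apply/subset_leq_card/subsetP => x.
  rewrite !inE => /andP[/orP[]/eqP-> // svJ].
  by have := indJ _ _ suJ svJ; move/Aut_graphP: auts ->; rewrite uv.
right; apply/eqP; rewrite eqn_leq alpha_leq_card -cardsT leq_alpha //.
apply/independentP => u v _ _; apply: contra noE => uv.
by apply/existsP; exists u; apply/existsP; exists v.
Qed.

(** * Expansion of independent sets *)

Lemma disjoint_nbhd (G : sgraph) (I : {set G}) :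
  independent I -> I :&: nbhd I = set0.
Proof.
move/independentP => indI; apply/setP => v; rewrite !inE.
apply/negP => /andP[vI /exists_inP[u uI uv]].
by have := indI _ _ uI vI; rewrite uv.
Qed.

Lemma card_independentU_nbhd (G : sgraph) (I : {set G}) :
  independent I -> #|I :|: nbhd I| = #|I| + #|nbhd I|.
Proof. by move=> /disjoint_nbhd disjI; rewrite cardsU disjI cards0 subn0. Qed.

(* Exchange: a maximum independent set [J] cannot be improved by replacing its
   part in the closed neighborhood of [I] by [I]. *)
Lemma leq_card_max_independent (G : sgraph) (I J : {set G}) :
  independent I -> independent J -> #|J| = alpha G ->
  #|I| <= #|(I :|: nbhd I) :&: J|.
Proof.
move=> indI /independentP indJ maxJ.
set D := I :|: nbhd I.
have disj : I :&: (J :\: D) = set0.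
  by apply/setP => x; rewrite !inE; case: (x \in I).
have : #|I :|: (J :\: D)| <= #|J|.
  rewrite maxJ; apply: leq_alpha; apply/independentP => u v.
  move/independentP: indI => indI.
  have far x y : x \in I -> y \in J :\: D -> ~~ adj x y.
    move=> xI /setDP[_]; rewrite !inE negb_or => /andP[_]; apply: contra => xy.
    by apply/exists_inP; exists x.
  case/setUP => uI /setUP[] vI; first exact: indI.
  - exact: far.
  - by rewrite adj_sym far.
  - by move/setDP: uI vI => [uJ _] /setDP[vJ _]; apply: indJ.
by rewrite cardsU disj cards0 subn0 -(cardsID D J) leq_add2r setIC.
Qed.

(** Average over [D = I :|: nbhd I]: the preimage of a maximum independent set under an automorphism
    is again maximum, so by the exchange argument it meets [D] in at least [#|I|] points. *)
Lemma expansion_bound (G : sgraph) (I : {set G}) :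
  vertex_transitive G -> independent I ->
  #|I| * #|G| <= alpha G * (#|I| + #|nbhd I|).
Proof.
move=> vtG indI; have [J indJ maxJ] := alpha_witness G.
rewrite -card_independentU_nbhd // -maxJ -(leq_pmul2r (Aut_graph_gt0 G)).
rewrite [leqRHS]mulnAC -(sum_translates id _ _ vtG) mulnAC mulnC leq_mul2l.
apply/orP; right; rewrite mulnC -sum_nat_const; apply: leq_sum => s auts.
have homs : homomorphism s by move=> x y; move/Aut_graphP: auts ->.
have := leq_card_max_independent indI (independent_preim homs indJ).
rewrite card_preim_perm => /(_ maxJ) /leq_trans -> //.
by apply/subset_leq_card/subsetP => x; rewrite !inE.
Qed.

(** * Isomorphisms and disjoint unions *)

Lemma alpha_bijective_hom (G H : sgraph) (f : G -> H) :
  bijective f -> homomorphism f -> alpha H <= alpha G.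
Proof.
move=> bijf homf; have [J indJ <-] := alpha_witness H.
rewrite -(on_card_preimset (f := f)); last exact: onW_bij.
exact/leq_alpha/independent_preim.
Qed.

Lemma alpha_isomorphic (G H : sgraph) : isomorphic G H -> alpha G = alpha H.
Proof.
case=> f bijf adjf; apply/eqP; rewrite eqn_leq (alpha_bijective_hom bijf).
  case: (bijf) => g fK gK; rewrite andbT.
  apply: (@alpha_bijective_hom _ _ g); first by exists f.
  by move=> x y; rewrite -adjf !gK.
by move=> x y; rewrite adjf.
Qed.

Lemma card_isomorphic (G H : sgraph) : isomorphic G H -> #|G| = #|H|.
Proof. by case=> f bijf _; apply: bij_eq_card bijf. Qed.

Lemma isomorphic_trans (G H K : sgraph) :
  isomorphic G H -> isomorphic H K -> isomorphic G K.
Proof.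
move=> [f bijf adjf] [g bijg adjg]; exists (g \o f); first exact: bij_comp.
by move=> x y; rewrite /= adjg adjf.
Qed.

Lemma alpha_disjoint_union (G H : sgraph) :
  alpha (disjoint_union G H) = alpha G + alpha H.
Proof.
apply/eqP; rewrite eqn_leq; apply/andP; split.
  have [J indJ <-] := alpha_witness (disjoint_union G H).
  have homl : @homomorphism G (disjoint_union G H) inl by [].
  have homr : @homomorphism H (disjoint_union G H) inr by [].
  have -> : #|J| = #|(inl @^-1: J)%SET| + #|(inr @^-1: J)%SET|.
    by rewrite -!sum1_card big_sumType /=; congr (_ + _); apply: eq_bigl => x;
       rewrite inE.
  by rewrite leq_add // leq_alpha // independent_preim.
have [I /independentP indI <-] := alpha_witness G.
have [J /independentP indJ <-] := alpha_witness H.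
pose U : {set disjoint_union G H} :=
  [set x | match x with inl u => u \in I | inr v => v \in J end].
have -> : #|I| + #|J| = #|U|.
  rewrite -!sum1_card big_sumType /=.
  by congr (_ + _); apply: eq_bigl => x; rewrite inE.
apply: leq_alpha; apply/independentP => -[u|u] [v|v]; rewrite !inE //=.
  exact: indI.
exact: indJ.
Qed.

Lemma card_disjoint_union (G H : sgraph) : #|disjoint_union G H| = #|G| + #|H|.
Proof. exact: card_sum. Qed.

(** * Decomposition of the powers of a disjoint union *)

Lemma isomorphic_tensorl (G H K : sgraph) :
  isomorphic G H -> isomorphic (tensor G K) (tensor H K).
Proof.
case=> f [g fK gK] adjf; exists (fun x : tensor G K => (f x.1, x.2)).
  by exists (fun x : tensor H K => (g x.1, x.2)) => -[x y] /=;
    rewrite ?fK ?gK.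
by move=> x y; rewrite /= /tensor_adj adjf.
Qed.

Lemma isomorphic_tensorDl (G H K : sgraph) :
  isomorphic (tensor (disjoint_union G H) K)
             (disjoint_union (tensor G K) (tensor H K)).
Proof.
pose f (x : tensor (disjoint_union G H) K) :
    disjoint_union (tensor G K) (tensor H K) :=
  match x.1 with inl u => inl (u, x.2) | inr v => inr (v, x.2) end.
exists f; last by move=> [[u|u] k] [[v|v] l].
exists (fun x => match x with inl y => (inl y.1, y.2) | inr y => (inr y.1, y.2) end).
  by move=> [[u|u] k].
by move=> [[u k]|[u k]].
Qed.

(* The components of a power of G1 + G2 that involve both factors, up to
   isomorphism; [K] will be G1 x G2. *)
Inductive union_of_equivalents (K : sgraph) : sgraph -> Prop :=
| Equiv_empty (X : sgraph) of #|X| = 0 : union_of_equivalents K X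
| Equiv_component X of vertex_transitive X & hom_to X K & hom_to K X :
    union_of_equivalents K X
| Equiv_union X Y of union_of_equivalents K X & union_of_equivalents K Y :
    union_of_equivalents K (disjoint_union X Y)
| Equiv_isomorphic X Y of isomorphic X Y & union_of_equivalents K Y :
    union_of_equivalents K X.

(** Each component has the ratio of [K] by the no-homomorphism lemma in both directions. In
    cross-multiplied form this equality is additive over disjoint unions and holds for empty [X]. *)
Lemma alpha_union_of_equivalents (K X : sgraph) :
  vertex_transitive K -> union_of_equivalents K X ->
  alpha X * #|K| = alpha K * #|X|.
Proof.
move=> vtK; elim=> {X} [X X0|X vtX XK KX|X Y _ IHX _ IHY|X Y XY _ IHY].
- by move: (alpha_leq_card X); rewrite X0 leqn0 => /eqP ->; rewrite muln0.
- exact: alpha_mul_hom_equiv.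
- by rewrite alpha_disjoint_union card_disjoint_union mulnDl mulnDr IHX IHY.
- by rewrite (alpha_isomorphic XY) (card_isomorphic XY).
Qed.

(** A further factor [G] keeps a component equivalent to [K]: project to [X] in one direction, and
    pair the maps from [K] to [X] and to [G] in the other. *)
Lemma union_of_equivalents_tensor (K G X : sgraph) :
  vertex_transitive G -> hom_to K G -> union_of_equivalents K X ->
  union_of_equivalents K (tensor X G).
Proof.
move=> vtG KG; elim=> {X} [X X0|X vtX XK KX|X Y _ IHX _ IHY|X Y XY _ IHY].
- by apply: Equiv_empty; rewrite card_tensor X0.
- apply: Equiv_component; first exact: vertex_transitive_tensor.
    exact: hom_to_trans (hom_to_fst _ _) XK.
  exact: hom_to_tensor.
- exact/(Equiv_isomorphic (isomorphic_tensorDl _ _ _))/Equiv_union.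
- exact/(Equiv_isomorphic (isomorphic_tensorl _ XY)).
Qed.

Lemma void_adj_sym : symmetric (fun _ _ : void => false).
Proof. by []. Qed.

Lemma void_adj_irr : irreflexive (fun _ : void => fun _ : void => false).
Proof. by []. Qed.

Definition empty_graph : sgraph := SGraph void_adj_sym void_adj_irr.

(** Distributivity gives six products; [A] and [B] stand for pure powers of [G1] and [G2], so the
    first two are the next pure powers and the other four form the new mixed part. *)
Lemma isomorphic_pow_union_step (A B M G1 G2 : sgraph) :
  isomorphic
    (tensor (disjoint_union (disjoint_union A B) M) (disjoint_union G1 G2))
    (disjoint_union
      (disjoint_union (tensor A G1) (tensor B G2))
      (disjoint_union (disjoint_union (tensor A G2) (tensor B G1))
                      (disjoint_union (tensor M G1) (tensor M G2)))).
Proof.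
pose S := tensor (disjoint_union (disjoint_union A B) M) (disjoint_union G1 G2).
pose T := disjoint_union
      (disjoint_union (tensor A G1) (tensor B G2))
      (disjoint_union (disjoint_union (tensor A G2) (tensor B G1))
                      (disjoint_union (tensor M G1) (tensor M G2))).
pose f (x : S) : T := match x with
  | (inl (inl a), inl g) => inl (inl (a, g))
  | (inl (inl a), inr h) => inr (inl (inl (a, h)))
  | (inl (inr b), inl g) => inr (inl (inr (b, g)))
  | (inl (inr b), inr h) => inl (inr (b, h))
  | (inr m, inl g) => inr (inr (inl (m, g)))
  | (inr m, inr h) => inr (inr (inr (m, h)))
  end.
pose f' (y : T) : S := match y with
  | inl (inl (a, g)) => (inl (inl a), inl g)
  | inr (inl (inl (a, h))) => (inl (inl a), inr h)
  | inr (inl (inr (b, g))) => (inl (inr b), inl g)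
  | inl (inr (b, h)) => (inl (inr b), inr h)
  | inr (inr (inl (m, g))) => (inr m, inl g)
  | inr (inr (inr (m, h))) => (inr m, inr h)
  end.
exists f.
  exists f'; first by move=> [[[a|b]|m] [g|h]].
  by move=> [[[a g]|[b h]]|[[[a h]|[b g]]|[[m g]|[m h]]]].
by move=> [[[a|b]|m] [g|h]] [[[a'|b']|m'] [g'|h']] //=;
  rewrite /tensor_adj /= andbF.
Qed.

Lemma pow_disjoint_union (G1 G2 : sgraph) n :
  vertex_transitive G1 -> vertex_transitive G2 ->
  exists2 M, union_of_equivalents (tensor G1 G2) M &
    isomorphic (tensor_pow (disjoint_union G1 G2) n.+1)
      (disjoint_union
        (disjoint_union (tensor_pow G1 n.+1) (tensor_pow G2 n.+1)) M).
Proof.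
move=> vt1 vt2; have K1 := hom_to_fst G1 G2; have K2 := hom_to_snd G1 G2.
elim: n => [|n [M equivM isoM]].
  (* The first power has no mixed component. *)
  exists empty_graph; first exact/Equiv_empty/card_void.
  exists inl; last by [].
  by exists (fun x => match x with inl y => y | inr v => of_void _ v end);
    [|case => // -[]].
set A := tensor_pow G1 n.+1; set B := tensor_pow G2 n.+1.
exists (disjoint_union (disjoint_union (tensor A G2) (tensor B G1))
                       (disjoint_union (tensor M G1) (tensor M G2))).
  (* The products with [M] are covered by induction. The products of [A] with [G2] and of [B] with
     [G1] are equivalent to [tensor G1 G2] because a graph and its powers map to each other. *)
  apply: Equiv_union; apply: Equiv_union; last 2 first.
  - exact: union_of_equivalents_tensor.
  - exact: union_of_equivalents_tensor.
  - apply: Equiv_component.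
    + exact/vertex_transitive_tensor/vt2/vertex_transitive_pow.
    + apply: hom_to_tensor; last exact: hom_to_snd.
      exact/(hom_to_trans (hom_to_fst _ _))/pow_hom_to.
    + by apply: hom_to_tensor => //; apply/(hom_to_trans K1)/hom_to_pow.
  - apply: Equiv_component.
    + exact/vertex_transitive_tensor/vt1/vertex_transitive_pow.
    + apply: hom_to_tensor; first exact: hom_to_snd.
      exact/(hom_to_trans (hom_to_fst _ _))/pow_hom_to.
    + by apply: hom_to_tensor => //; apply/(hom_to_trans K2)/hom_to_pow.
exact: isomorphic_trans (isomorphic_tensorl _ isoM)
         (isomorphic_pow_union_step _ _ _ _ _).
Qed.
Local Open Scope ring_scope.

(** * Independence and expansion ratios as real numbers *)

Lemma indep_ratio_eq (R : realType) (G H : sgraph) :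
  (0 < #|G|)%N -> (0 < #|H|)%N -> (alpha G * #|H| = alpha H * #|G|)%N ->
  indep_ratio R G = indep_ratio R H.
Proof.
move=> G0 H0 e; apply/eqP; rewrite /indep_ratio eqr_div ?pnatr_eq0 -?lt0n //.
by rewrite -!natrM e.
Qed.

Lemma le_indep_ratio (R : realType) (G H : sgraph) :
  (0 < #|G|)%N -> vertex_transitive H -> hom_to G H ->
  indep_ratio R H <= indep_ratio R G.
Proof.
move=> G0 vtH GH; case: (posnP #|H|) => [H0|H0].
  (* For an empty [H] the ratio is 0, since the inverse of 0 is 0. *)
  by rewrite /indep_ratio H0 invr0 mulr0 divr_ge0.
rewrite /indep_ratio ler_pdivrMr ?ltr0n // mulrAC ler_pdivlMr ?ltr0n //.
by rewrite -!natrM ler_nat no_homomorphism.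
Qed.

Lemma indep_ratio_gt0 (R : realType) (G : sgraph) :
  (0 < #|G|)%N -> 0 < indep_ratio R G.
Proof. by move=> G0; rewrite divr_gt0 ?ltr0n ?alpha_gt0. Qed.

(** The upper bound is [expansion_bound]. For the lower bound take a maximum independent set: it is
    disjoint from its neighborhood, so the denominator is at most [#|G|]. *)
Lemma expansion_ratio_vt (R : realType) (G : sgraph) :
  (0 < #|G|)%N -> vertex_transitive G ->
  expansion_ratio R G = indep_ratio R G.
Proof.
move=> G0 vtG; apply/eqP; rewrite eq_le; apply/andP; split.
  apply: bigmax_le => [|I /andP[indI In0]]; first exact/ltW/indep_ratio_gt0.
  have I0 : (0 < #|I| + #|nbhd I|)%N by rewrite addn_gt0 card_gt0 In0.
  rewrite /indep_ratio ler_pdivrMr ?ltr0n // mulrAC ler_pdivlMr ?ltr0n //.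
  by rewrite -!natrM ler_nat expansion_bound.
have [J indJ maxJ] := alpha_witness G.
have Jpos : (0 < #|J|)%N by rewrite maxJ alpha_gt0.
apply: (bigmax_sup J); first by rewrite indJ -card_gt0.
rewrite /indep_ratio -maxJ ler_wpM2l ?ler0n // lef_pV2 ?posrE ?ltr0n //.
  by rewrite ler_nat -card_independentU_nbhd // max_card.
by rewrite addn_gt0 Jpos.
Qed.

(** By [alpha_half_or_full], a ratio above one half already equals 1. *)
Lemma expansion_ratio_star_vt (R : realType) (G : sgraph) :
  (0 < #|G|)%N -> vertex_transitive G ->
  expansion_ratio_star R G = indep_ratio R G.
Proof.
move=> G0 vtG; rewrite /expansion_ratio_star expansion_ratio_vt //.
case: ifP => //; case: (alpha_half_or_full vtG) => [half|full].
  rewrite /indep_ratio ler_pdivrMr ?ltr0n // mulrAC ler_pdivlMr //.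
  by rewrite mul1r -natrM ler_nat half.
by rewrite /indep_ratio full divff // pnatr_eq0 -lt0n.
Qed.

(** * Fractional chromatic number and ultimate ratios *)

Import classical_sets.

(* The optimal coloring gives equal weight to all translates of a maximum
   independent set. *)
Lemma chi_f_vt (R : realType) (G : sgraph) :
  (0 < #|G|)%N -> vertex_transitive G -> chi_f R G = (indep_ratio R G)^-1.
Proof.
move=> G0 vtG; rewrite /indep_ratio invf_div /chi_f.
set S := (X in inf X).
have a0 : 0 < (alpha G)%:R :> R by rewrite ltr0n alpha_gt0.
(* Summing the covering inequalities over all vertices counts the weight of each independent [I]
   exactly [#|I|] times, hence at most [alpha G] times. *)
have lbS : lbound S (#|G|%:R / (alpha G)%:R).
  move=> _ [w [w_ge0 w_ge1] <-]; rewrite ler_pdivrMr // mulr_suml.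
  apply: (@le_trans _ _ (\sum_(v : G) \sum_(I : {set G} | independent I && (v \in I)) w I)).
    by rewrite -sum1_card natr_sum; apply: ler_sum => v _; apply: w_ge1.
  rewrite (exchange_big_dep (@independent G)) /=; last by move=> ? ? _ /andP[].
  apply: ler_sum => I indI; rewrite (eq_bigl (mem I)); last first.
    by move=> v; rewrite indI.
  rewrite sumr_const -[leLHS]mulr_natr ler_wpM2l ?w_ge0 //.
  by rewrite ler_nat leq_alpha.
have [J indJ maxJ] := alpha_witness G.
have indsJ (s : {perm G}) : s \in Aut_graph G -> independent (s @^-1: J).
  by move=> /Aut_graphP auts; apply: independent_preim indJ => x y; rewrite auts.
have A0 : (#|Aut_graph G|%:R : R) != 0.
  by rewrite pnatr_eq0 -lt0n Aut_graph_gt0.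
(* By [card_Aut_translates] each vertex lies in [#|Aut_graph G| * alpha G / #|G|] translates of [J],
   so weight [k] per automorphism covers it exactly once. Different automorphisms may give the same
   translate; [w] adds up their weights. *)
pose k : R := #|G|%:R / (#|Aut_graph G|%:R * (alpha G)%:R).
pose w (I : {set G}) : R := \sum_(s in Aut_graph G | (s @^-1: J)%SET == I) k.
have k0 : 0 <= k by rewrite divr_ge0 // -natrM ler0n.
have inS : S (#|G|%:R / (alpha G)%:R).
  exists w.
    split=> [I _|v]; first exact: sumr_ge0.
    rewrite (exchange_big_dep (mem (Aut_graph G))) /=; last first.
      by move=> ? ? _ /andP[].
    rewrite (eq_bigr (fun s : {perm G} => if s v \in J then k else 0)); last first.
      move=> s auts; case: ifP => svJ.
        rewrite (big_pred1 (s @^-1: J)%SET) // => I.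
        rewrite auts /= eq_sym; apply/andP/eqP => [[_ /eqP]//|->].
        by rewrite indsJ // inE svJ.
      rewrite big_pred0 // => I; rewrite auts /=; apply/negP.
      by move=> /andP[/andP[_ vI] /eqP e]; move: vI; rewrite -e inE svJ.
    rewrite -big_mkcondr /= sumr_const.
    have /(congr1 (fun n => n%:R : R)) := card_Aut_translates J v vtG.
    rewrite !natrM maxJ => e.
    rewrite -mulr_natr (_ : #|_| = #|[set s in Aut_graph G | s v \in J]|); last first.
      by apply: eq_card => s; rewrite [in RHS]inE.
    by rewrite /k mulrAC e [X in _ / X]mulrC divff // mulf_neq0 // gt_eqF.
  rewrite (exchange_big_dep (mem (Aut_graph G))) /=; last by move=> ? ? _ /andP[].
  rewrite (eq_bigr (fun=> k)) ?sumr_const; last first.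
    move=> s auts; rewrite (big_pred1 (s @^-1: J)%SET) // => I.
    rewrite auts /= eq_sym; apply/andP/eqP => [[_ /eqP]//|->].
    by rewrite indsJ.
  by rewrite -mulr_natr /k; field; rewrite A0 gt_eqF.
apply/eqP; rewrite eq_le; apply/andP; split.
  by apply: ge_inf => //; exists (#|G|%:R / (alpha G)%:R).
by apply: lb_le_inf => //; exists (#|G|%:R / (alpha G)%:R).
Qed.

(** The sequence is constant by [alpha_pow], also at index 0, where the power is [G] by
    convention. *)
Lemma ultimate_ratio_vt (R : realType) (G : sgraph) :
  (0 < #|G|)%N -> vertex_transitive G ->
  ultimate_ratio R G = indep_ratio R G.
Proof.
move=> G0 vtG; rewrite /ultimate_ratio.
rewrite (_ : (fun n => _) = fun=> indep_ratio R G) ?lim_cst //.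
apply/boolp.funext => n; apply: indep_ratio_eq => //; last exact: alpha_pow.
by case: n => [//|n]; rewrite card_tensor_powS expn_gt0 G0.
Qed.

(* The components of (G1 + G2)^n using both factors have the ratio of G1 x G2
   and the two others have an exponentially small share of the vertices. *)
Lemma ultimate_ratio_disjoint_union (R : realType) (G1 G2 : sgraph) :
  (0 < #|G1|)%N -> (0 < #|G2|)%N ->
  vertex_transitive G1 -> vertex_transitive G2 ->
  ultimate_ratio R (disjoint_union G1 G2) = indep_ratio R (tensor G1 G2).
Proof.
move=> pos1 pos2 vt1 vt2; rewrite /ultimate_ratio.
pose v1 : R := #|G1|%:R; pose v2 : R := #|G2|%:R; pose v := v1 + v2.
have v1_gt0 : 0 < v1 by rewrite ltr0n.
have v2_gt0 : 0 < v2 by rewrite ltr0n.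
have v_gt0 : 0 < v by rewrite addr_gt0.
pose b := indep_ratio R (tensor G1 G2).
(* The ratio is the average of those of [G1], [G2] and [tensor G1 G2], weighted by the shares of
   vertices in the two pure powers and in the mixed part [M]. Eliminating the share of [M] leaves
   two geometric error terms. *)
have ratioE n : indep_ratio R (tensor_pow (disjoint_union G1 G2) n.+1)
    = b + ((indep_ratio R G1 - b) * (v1 / v) ^+ n.+1
           + (indep_ratio R G2 - b) * (v2 / v) ^+ n.+1).
  have [M equivM isoM] := pow_disjoint_union n vt1 vt2.
  have cardW : #|tensor_pow (disjoint_union G1 G2) n.+1|%:R = v ^+ n.+1 :> R.
    by rewrite card_tensor_powS card_disjoint_union natrX natrD.
  have card1 : #|tensor_pow G1 n.+1|%:R = v1 ^+ n.+1 :> R.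
    by rewrite card_tensor_powS natrX.
  have card2 : #|tensor_pow G2 n.+1|%:R = v2 ^+ n.+1 :> R.
    by rewrite card_tensor_powS natrX.
  have cardM : v ^+ n.+1 = v1 ^+ n.+1 + v2 ^+ n.+1 + #|M|%:R.
    by rewrite -cardW (card_isomorphic isoM) !card_disjoint_union !natrD
      card1 card2.
  have alpha1 : (alpha (tensor_pow G1 n.+1))%:R = indep_ratio R G1 * v1 ^+ n.+1.
    have /(congr1 (fun n => n%:R : R)) := alpha_pow n.+1 vt1.
    rewrite !natrM card1 /indep_ratio mulrAC => <-.
    by rewrite mulfK // gt_eqF.
  have alpha2 : (alpha (tensor_pow G2 n.+1))%:R = indep_ratio R G2 * v2 ^+ n.+1.
    have /(congr1 (fun n => n%:R : R)) := alpha_pow n.+1 vt2.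
    rewrite !natrM card2 /indep_ratio mulrAC => <-.
    by rewrite mulfK // gt_eqF.
  have alphaM : (alpha M)%:R = b * #|M|%:R.
    have /(congr1 (fun n => n%:R : R)) := alpha_union_of_equivalents
      (vertex_transitive_tensor vt1 vt2) equivM.
    rewrite !natrM /b /indep_ratio mulrAC => <-.
    by rewrite mulfK // card_tensor natrM mulf_neq0 ?gt_eqF.
  rewrite {1}/indep_ratio cardW (alpha_isomorphic isoM) !alpha_disjoint_union.
  rewrite !natrD alpha1 alpha2 alphaM !expr_div_n.
  have vn : v ^+ n.+1 != 0 by rewrite expf_neq0 // gt_eqF.
  have -> : #|M|%:R = v ^+ n.+1 - v1 ^+ n.+1 - v2 ^+ n.+1 by rewrite cardM; ring.
  by field.
have geo c x : 0 < x -> x < v ->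
    ((c * (x / v) ^+ n.+1) @[n --> \oo] --> (0 : R))%classic.
  move=> x0 xv; rewrite -[X in (_ --> X)%classic](mulr0 c).
  apply: cvgMl_tmp.
  rewrite (cvg_shiftS (fun n => (x / v) ^+ n)); apply: cvg_expr.
  by rewrite ger0_norm ?divr_ge0 ?ltW // ltr_pdivrMr // mul1r.
(* The closed form is available only from the first power on; the shift does not change the
   limit. *)
apply: cvg_lim => //; rewrite -cvg_shiftS /=.
rewrite (_ : (fun n => _) = fun n => b + ((indep_ratio R G1 - b) * (v1 / v) ^+ n.+1
           + (indep_ratio R G2 - b) * (v2 / v) ^+ n.+1)); last first.
  by apply/boolp.funext.
have -> : indep_ratio R (tensor G1 G2) = b + (0 + 0) by rewrite !addr0.
apply: cvgD; first exact: cvg_cst.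
apply: cvgD; apply: geo => //; rewrite /v.
  by rewrite ltrDl.
by rewrite ltrDr.
Qed.

Theorem theorem3p1 (R : realType) (G1 G2 : sgraph)
    (G1_nonempty : (0 < #|G1|)%N) (G2_nonempty : (0 < #|G2|)%N)
    (G1_vt : vertex_transitive G1) (G2_vt : vertex_transitive G2) :
  [<-> indep_ratio R (tensor G1 G2)
         <= Num.max (expansion_ratio_star R G1) (expansion_ratio_star R G2);
       expansion_ratio_star R (tensor G1 G2)
         <= Num.max (expansion_ratio_star R G1) (expansion_ratio_star R G2);
       chi_f R (tensor G1 G2) = Num.min (chi_f R G1) (chi_f R G2);
       ultimate_ratio R (disjoint_union G1 G2)
         = Num.max (ultimate_ratio R G1) (ultimate_ratio R G2)].
Proof.
have K_nonempty : (0 < #|tensor G1 G2|)%N by rewrite card_tensor muln_gt0 G1_nonempty.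
have K_vt := vertex_transitive_tensor G1_vt G2_vt.
rewrite ultimate_ratio_disjoint_union // !ultimate_ratio_vt //.
rewrite !expansion_ratio_star_vt // !chi_f_vt //.
have le1 := le_indep_ratio R K_nonempty G1_vt (hom_to_fst G1 G2).
have le2 := le_indep_ratio R K_nonempty G2_vt (hom_to_snd G1 G2).
have pos1 := indep_ratio_gt0 R G1_nonempty.
have pos2 := indep_ratio_gt0 R G2_nonempty.
(* Inversion reverses the order of positive numbers. *)
have -> : Num.min (indep_ratio R G1)^-1 (indep_ratio R G2)^-1
    = (Num.max (indep_ratio R G1) (indep_ratio R G2))^-1.
  by case: (leP (indep_ratio R G1) (indep_ratio R G2)) => le12;
    [rewrite min_r|rewrite min_l] => //; rewrite lef_pV2 ?posrE // ltW.
have max_le : Num.max (indep_ratio R G1) (indep_ratio R G2)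
    <= indep_ratio R (tensor G1 G2) by rewrite ge_max le1.
(* The first two statements have become the same inequality. Antisymmetry with [max_le] makes it an
   equality, whose inverted form is the third statement. *)
tfae=> [//|le_max|/invr_inj//|->//].
by congr _^-1; apply/eqP; rewrite eq_le le_max.
Qed.
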